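(* Let $n>1$. The parametric maximum likelihood degree of the MA$(1)$ model with sample size $n$ equals $8(n-1)$. That is, for generic data $\mathbf y\in\mathbb R^n$, the likelihood equations $$\frac{\partial \ell}{\partial a_0}(a_0,a_1)=0,\qquad \frac{\partial \ell}{\partial a_1}(a_0,a_1)=0$$ have exactly $8(n-1)$ complex solutions $(a_0,a_1)\in\mathbb C^2$ with $\det\Sigma(a_0,a_1)\neq 0$.
   Context: MA$(1)$ model: $Y_t=a_0Z_t+a_1Z_{t-1}$ with $(Z_t)_{t\in\mathbb Z}$ i.i.d. standard normal. The covariance matrix of $(Y_1,\dots,Y_n)$ is the $n\times n$ symmetric tridiagonal Toeplitz matrix $\Sigma=\Sigma(a_0,a_1)$ with diagonal entries $a_0^2+a_1^2$, entries $a_0a_1$ on the first sub- and superdiagonal, and all other entries $0$. For data $\mathbf y=(y_1,\dots,y_n)^\top$ the log-likelihood (up to additive and multiplicative constants) is $$\ell(a_0,a_1)=-\log\det\Sigma-\mathbf y^\top\Sigma^{-1}\mathbf y .$$ The likelihood equations are the vanishing of the partial derivatives, which are rational functions of $(a_0,a_1)$: $$\frac{\partial\ell}{\partial a_i}=-\operatorname{tr}\Big(\Sigma^{-1}\frac{\partial\Sigma}{\partial a_i}\Big)+\mathbf y^\top\Sigma^{-1}\frac{\partial\Sigma}{\partial a_i}\Sigma^{-1}\mathbf y ,$$ considered for complex $(a_0,a_1)$ with $\det\Sigma\ne0$. The parametric maximum likelihood degree is the number of complex solutions of these equations for generic data. ''Generic data'' means all $\mathbf y$ outside some proper algebraic subset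 (zero set of a nonzero polynomial). *)

(* Defs.v *)
From HB Require Import structures.
From mathcomp Require Import all_boot all_order all_algebra.
From mathcomp Require Import complex.
From mathcomp Require Import classical_sets functions cardinality reals.
From mathcomp Require Import mpoly.

Set Implicit Arguments.
Unset Strict Implicit.
Unset Printing Implicit Defensive.

Import GRing.Theory Num.Theory.

Local Open Scope ring_scope.
Local Open Scope complex_scope.

(* Over an arbitrary commutative ring, so that it can be instantiated both at
   complex parameters and at the indeterminates of a polynomial ring. *)
Definition MA1_cov (K : comNzRingType) (n : nat) (a : 'I_2 -> K) : 'M[K]_n :=
  \matrix_(i, j)
    if i == j then a 0 ^+ 2 + a 1 ^+ 2
    else if (i.+1 == j :> nat) || (j.+1 == i :> nat) then a 0 * a 1
    else 0.

(* The entries of the covariance matrix are polynomials in (a_0, a_1): they are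
   differentiated formally in the k-th variable, then evaluated at a. *)
Definition MA1_dcov (K : comNzRingType) (n : nat) (k : 'I_2) (a : 'I_2 -> K) :
    'M[K]_n :=
  map_mx (fun p : {mpoly K[2]} => p^`M(k).@[a])
         (MA1_cov n (fun i => 'X_i)).

(* The partial derivative in a_k of
   - log (\det Sigma) - y^T Sigma^-1 y, by Jacobi's formula and
   d(Sigma^-1) = - Sigma^-1 dSigma Sigma^-1: a rational function of a, used
   also at complex a, where log is not available.  It is meaningful only where \det Sigma != 0. *)
Definition MA1_score (K : fieldType) (n : nat) (y : 'cV[K]_n) (k : 'I_2)
    (a : 'I_2 -> K) : K :=
  let S := MA1_cov n a in
  let dS := MA1_dcov n k a in
  - \tr (invmx S *m dS) + (y^T *m invmx S *m dS *m invmx S *m y) 0 0.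

Local Open Scope classical_set_scope.
Local Open Scope card_scope.

Definition MA1_likelihood_solutions (R : realType) (n : nat) (y : 'cV[R]_n) :
    set 'rV[R[i]]_2 :=
  [set a : 'rV[R[i]]_2 | \det (MA1_cov n (a 0)) != 0 /\
           forall k : 'I_2, MA1_score (map_mx (real_complex R) y) k (a 0) = 0].

Definition for_generic (R : realType) (n : nat) (Q : 'cV[R]_n -> Prop) : Prop :=
  exists2 P : {mpoly R[n]}, P != 0 &
    forall y : 'cV[R]_n, P.@[fun i => y i 0] != 0 -> Q y.

(* A relation rather than a number: d is the number of complex solutions of
   the likelihood equations for generic data. *)
Definition is_MA1_parametric_ML_degree (R : realType) (n d : nat) : Prop :=
  for_generic (fun y : 'cV[R]_n => MA1_likelihood_solutions y #= `I_d).

(* Main.v *)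
Require Import Defs.
From mathcomp Require Import all_boot all_order all_algebra.
From mathcomp Require Import separable complex mpoly.
From mathcomp Require Import boolp classical_sets functions cardinality reals.
From mathcomp Require trigo.
From mathcomp Require Import zify ring lra.

(* Write [Sigma = s I + t T] with [s = a_0^2 + a_1^2], [t = a_0 a_1] and [T] the
   adjacency matrix of a path, whose eigenvalues [lam_k = 2 cos (k pi / (n+1))]
   are distinct and lie in (-2, 2).  In an orthonormal eigenbasis the scores are
   [2 a_0 A + a_1 B] and [2 a_1 A + a_0 B], where [A] and [B] are the partial
   derivatives in [s] and [t]; when [t <> 0], which is generically forced, they vanish iff
   [s A + t B = 0] and [(a_0^2 - a_1^2) A = 0].  With [x = s / t],
   [D = \prod_k (x + lam_k)] ([spec_poly]), [v] the squared coordinates of [y] and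
   [N = \sum_k v_k D / (x + lam_k)] ([data_poly]), the first equation determines
   [t = N(x) / (n D(x))] and the second one becomes
   [(x^2 - 4) (n N' D - (n - 1) N D')(x) = 0] ([lik_crit]).  The second factor generically
   has 2n - 3 distinct roots; each of them gives four pairs (a_0, a_1), while
   the roots 2 and -2 give two each: 4 (2n - 3) + 4 = 8 (n - 1).

   Genericity is the non-vanishing of a resultant, so one complex data vector
   suffices.  As [N] may be any polynomial of degree less than n, take
   [N = 1 + c (x - 2)^(n-1)]: then [n N' D - (n - 1) N D'] runs through a pencil
   spanned by two coprime polynomials, whose members are separable for all but
   finitely many [c]. *)

Set Implicit Arguments.
Unset Strict Implicit.
Unset Printing Implicit Defensive.

Import Order.TTheory GRing.Theory Num.Theory.
Local Open Scope ring_scope.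
Local Open Scope complex_scope.

(** * Diagonalisation of the path adjacency matrix *)

Definition path_mx (K : comNzRingType) n : 'M[K]_n :=
  \matrix_(i, j) ((i.+1 == j :> nat) || (j.+1 == i :> nat))%:R.

Lemma tr_path_mx (K : comNzRingType) n : (path_mx K n)^T = path_mx K n.
Proof. by apply/matrixP=> i j; rewrite !mxE orbC. Qed.

(** The two boundary zeros make the end vertices, which lack a neighbour, obey the same three-term
    rule as the inner ones; [f] numbers the vertices from 1. *)
Lemma sum_path_mx (K : comNzRingType) n (f : nat -> K) (j : 'I_n) :
  f 0%N = 0 -> f n.+1 = 0 ->
  \sum_(i < n) f i.+1 * path_mx K n i j = f j + f j.+2.
Proof.
move=> f0 fn.
have -> : \sum_(i < n) f i.+1 * path_mx K n i j =
    \sum_(i < n | i.+1 == j :> nat) f i.+1 + \sum_(i < n | j.+1 == i :> nat) f i.+1.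
  rewrite [X in X + _]big_mkcond [X in _ + X]big_mkcond -big_split /=.
  apply: eq_bigr => i _; rewrite !mxE.
  have [e1|_] := eqVneq i.+1 (j : nat); have [e2|_] := eqVneq j.+1 (i : nat);
    rewrite /= ?mulr1 ?mulr0 ?addr0 ?add0r //.
  by have := ltnn i; rewrite -{2}e2 -e1 ltnS leqnSn.
congr (_ + _).
  case: j => [[|j] /= ltj]; first by rewrite big_pred0.
  by rewrite (big_pred1 (Ordinal (ltnW ltj))).
case: (ltnP j.+1 n) => [lt|ge].
  by rewrite (big_pred1 (Ordinal lt)) // => i; rewrite -val_eqE /= eq_sym.
have -> : j.+2 = n.+1 by congr _.+1; apply/eqP; rewrite eqn_leq ge ltn_ord.
rewrite fn big_pred0 // => i; apply/negbTE; rewrite neq_ltn orbC.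
by rewrite (leq_trans (ltn_ord i) ge).
Qed.

(** The vectors with entries sin (j th_k) are eigenvectors by sin (u - th) + sin (u + th) = 2 cos th
    sin u; the boundary values vanish because (n + 1) th_k is a multiple of pi. *)
Lemma path_mx_diag (R : realType) n :
  exists (U : 'M[R]_n) (lam : 'I_n -> R),
  [/\ U *m U^T = 1%:M, injective lam, forall k, -2 < lam k < 2 &
      path_mx R n = U^T *m diag_mx (\row_k lam k) *m U].
Proof.
pose pi : R := trigo.pi.
have pi_gt0 : 0 < pi by exact: trigo.pi_gt0.
pose th k : R := k.+1%:R * pi / n.+1%:R.
have n1_gt0 : 0 < n.+1%:R :> R by rewrite ltr0n.
have th_int (k : 'I_n) : 0 < th k < pi.
  rewrite /th divr_gt0 ?mulr_gt0 ?ltr0n //=.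
  by rewrite ltr_pdivrMr // mulrC ltr_pM2l // ltr_nat ltnS.
have th_in (k : 'I_n) : th k \in `[0, pi].
  by rewrite in_itv /=; case/andP: (th_int k) => *; rewrite !ltW.
pose lam (k : 'I_n) : R := 2 * trigo.cos (th k).
have lam_inj : injective lam.
  move=> k l /(mulfI _) e; have /trigo.cos_inj : trigo.cos (th k) = trigo.cos (th l).
    by apply: e; rewrite pnatr_eq0.
  move=> /(_ (th_in k) (th_in l)) /(divIf _) e'.
  have /(mulIf _) : k.+1%:R * pi = l.+1%:R * pi by apply: e'; rewrite lt0r_neq0.
  move=> /(_ (lt0r_neq0 pi_gt0)) /eqP; rewrite eqr_nat eqSS => /eqP.
  exact: val_inj.
have lam_int k : -2 < lam k < 2.
  have pi_in : pi \in `[0, pi] by rewrite in_itv /= lexx ltW.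
  have o_in : 0 \in `[0, pi] by rewrite in_itv /= lexx ltW.
  case/andP: (th_int k) => k0 k1; apply/andP; split; rewrite /lam.
    have h : trigo.cos pi < trigo.cos (th k) by rewrite trigo.ltr_cos.
    by rewrite trigo.cospi in h; lra.
  have h : trigo.cos (th k) < trigo.cos (0 : R) by rewrite trigo.ltr_cos.
  by rewrite trigo.cos0 in h; lra.
pose V : 'M[R]_n := \matrix_(k, j) trigo.sin (j.+1%:R * th k).
pose L := diag_mx (\row_k lam k).
have VT : V *m path_mx R n = L *m V.
  apply/matrixP=> k j; rewrite mul_diag_mx !mxE.
  pose f i := trigo.sin (i%:R * th k).
  rewrite (eq_bigr (fun i => f (nat_of_ord i).+1 * path_mx R n i j)); last first.
    by move=> i _; rewrite mxE.
  rewrite (sum_path_mx (f := f)) /f.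
  - have -> : j%:R * th k = j.+1%:R * th k - th k by rewrite -natr1; ring.
    have -> : j.+2%:R * th k = j.+1%:R * th k + th k by rewrite -[j.+2%:R]natr1; ring.
    rewrite trigo.sinB trigo.sinD /lam; ring.
  - by rewrite mul0r trigo.sin0.
  have -> : n.+1%:R * th k = k.+1%:R * pi by rewrite /th mulrC divfK // lt0r_neq0.
  elim: (k.+1) => [|m IH]; first by rewrite mul0r trigo.sin0.
  by rewrite -natr1 mulrDl mul1r trigo.sinDpi IH oppr0.
(* Orthogonality needs no trigonometric sum: the Gram matrix commutes with the diagonal matrix [L],
   whose entries are distinct, so it is diagonal. *)
pose G := V *m V^T.
have LG : L *m G = G *m L.
  rewrite /G mulmxA -VT -mulmxA -[path_mx _ _]tr_path_mx -trmx_mul VT trmx_mul.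
  by rewrite tr_diag_mx mulmxA.
have G0 k l : k != l -> G k l = 0.
  move=> kl; move/matrixP: LG => /(_ k l); rewrite mul_diag_mx mul_mx_diag !mxE.
  move=> /eqP; rewrite mulrC -subr_eq0 -mulrBr mulf_eq0 subr_eq0 => /orP[/eqP //|].
  by rewrite (inj_eq lam_inj) (negbTE kl).
have Gpos k : 0 < G k k.
  (* The first coordinate sin th_k alone makes the norm positive. *)
  rewrite mxE (bigD1 (Ordinal (leq_ltn_trans (leq0n k) (ltn_ord k)))) //=.
  apply: ltr_wpDr.
    by apply: sumr_ge0 => i _; rewrite !mxE -expr2 sqr_ge0.
  by rewrite !mxE -expr2 exprn_gt0 // mul1r trigo.sin_gt0_pi.
pose S := diag_mx (\row_k (Num.sqrt (G k k))^-1).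
exists (S *m V), lam.
have UU : S *m V *m (S *m V)^T = 1%:M.
  rewrite trmx_mul tr_diag_mx mulmxA -(mulmxA S) -/G; apply/matrixP=> k l.
  have SHS H : (S *m H *m S) k l = (Num.sqrt (G k k))^-1 * H k l * (Num.sqrt (G l l))^-1.
    by rewrite mul_mx_diag mul_diag_mx !mxE.
  rewrite SHS [RHS]mxE.
  have [<-|kl] := eqVneq k l; last by rewrite (G0 _ _ kl) mulr0 mul0r.
  rewrite mulrAC -invfM -expr2 sqr_sqrtr ?(ltW (Gpos k)) //.
  by rewrite mulVf // lt0r_neq0.
split=> //.
rewrite -mulmxA -/L (mulmxA L) /L diag_mxC -mulmxA -/L -VT !mulmxA.
by rewrite -(mulmxA _ S V) (mulmx1C UU) mul1mx.
Qed.

(** * The critical polynomial *)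

Lemma deriv_prod (K : comNzRingType) (I : eqType) (r : seq I) (f : I -> {poly K}) :
  uniq r ->
  (\prod_(i <- r) f i)^`() = \sum_(i <- r) (f i)^`() * \prod_(j <- r | j != i) f j.
Proof.
elim: r => [|i r IH] /=; first by rewrite !big_nil derivC.
case/andP=> ir /IH{}IH; rewrite !big_cons eqxx derivM IH.
have e j : j \in r -> i != j by apply: contraTneq => <-.
congr (_ * _ + _).
  by rewrite [RHS]big_seq_cond [LHS]big_seq; apply: eq_bigl => j;
     case: (boolP (j \in r)) => //= /e; rewrite eq_sym.
rewrite mulr_sumr; apply: eq_big_seq => j /e ij.
by rewrite big_cons ij mulrCA.
Qed.

Lemma coefM_top (K : comNzRingType) (p q : {poly K}) m l :
  (size p <= m.+1)%N -> (size q <= l.+1)%N -> (p * q)`_(m + l) = p`_m * q`_l.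
Proof.
move=> szp szq; have ltm : (m < (m + l).+1)%N by rewrite ltnS leq_addr.
rewrite coefM (bigD1 (Ordinal ltm)) //= addKn big1 ?addr0 // => i neq.
have [lt|gt|e] := ltngtP i m.
- rewrite [q`__]nth_default ?mulr0 // (leq_trans szq) //.
  by rewrite -addnBAC ?(ltnW lt) // -{1}[l]add0n ltn_add2r subn_gt0.
- by rewrite nth_default ?mul0r // (leq_trans szp).
- by case/eqP: neq; apply: val_inj.
Qed.

Section LikelihoodPoly.
Variables (K : comNzRingType) (n : nat).
Implicit Types (lam v : 'I_n -> K).

(** At the eigenvalues of T this is det (x I + T), and [data_poly] is y^T adj (x I + T) y when [v]
    holds the squared coordinates of y in the eigenbasis. *)
Definition spec_poly lam : {poly K} := \prod_k ('X + (lam k)%:P).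
Definition spec_minor lam k : {poly K} := \prod_(j | j != k) ('X + (lam j)%:P).
Definition data_poly lam v : {poly K} := \sum_k v k *: spec_minor lam k.
(** The numerator of the logarithmic derivative of N^n / D^(n-1). Substituting t = N / (n D) into
    the log-likelihood leaves - log (N^n / D^(n-1)) up to a constant. *)
Definition lik_op lam (p : {poly K}) : {poly K} :=
  n%:R *: (p^`() * spec_poly lam) - n.-1%:R *: (p * (spec_poly lam)^`()).
Definition lik_poly lam v : {poly K} := lik_op lam (data_poly lam v).

(** At x = s / t the factor x^2 - 4 is ((a_0^2 - a_1^2) / t)^2: it vanishes where the map from (a_0,
    a_1) to (s, t) has a singular Jacobian. *)
Definition lik_crit lam v : {poly K} := lik_poly lam v * ('X^2 - 4%:R%:P).
(** Coprimality with this product packs three conditions on the roots of [lik_crit]: they are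
    simple, D does not vanish there, and neither does N, so that t is finite and non-zero. *)
Definition lik_disc lam v : {poly K} :=
  (lik_crit lam v)^`() * spec_poly lam * data_poly lam v.

Lemma spec_polyD1 lam k : spec_poly lam = ('X + (lam k)%:P) * spec_minor lam k.
Proof. by rewrite /spec_poly (bigD1 k). Qed.

Lemma monicXaddC (a : K) : 'X + a%:P \is monic.
Proof. by rewrite -[a]opprK polyCN monicXsubC. Qed.

Lemma monic_spec_poly lam : spec_poly lam \is monic.
Proof. by apply: monic_prod => i _; apply: monicXaddC. Qed.

Lemma monic_spec_minor lam k : spec_minor lam k \is monic.
Proof. by apply: monic_prod => i _; apply: monicXaddC. Qed.

Lemma spec_polyE lam :
  spec_poly lam = \prod_(a <- [seq - lam k | k <- enum 'I_n]) ('X - a%:P).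
Proof.
by rewrite big_map big_enum; apply: eq_bigr => k _; rewrite polyCN opprK.
Qed.

Lemma size_spec_poly lam : size (spec_poly lam) = n.+1.
Proof. by rewrite spec_polyE size_prod_XsubC size_map size_enum_ord. Qed.

Lemma size_spec_minor lam k : size (spec_minor lam k) = n.
Proof.
have := size_spec_poly lam; rewrite (spec_polyD1 lam k) size_monicM.
- by rewrite -[lam k]opprK polyCN size_XsubC => -[].
- exact: monicXaddC.
- exact: monic_neq0 (monic_spec_minor lam k).
Qed.

Lemma size_deriv_spec_poly lam : (size (spec_poly lam)^`() <= n)%N.
Proof.
have := lt_size_deriv (monic_neq0 (monic_spec_poly lam)).
by rewrite size_spec_poly ltnS.
Qed.

Lemma deriv_spec_poly lam : (spec_poly lam)^`() = \sum_k spec_minor lam k.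
Proof.
rewrite deriv_prod ?index_enum_uniq //; apply: eq_bigr => k _.
by rewrite derivD derivX derivC addr0 mul1r.
Qed.

Lemma coef_spec_poly lam : (spec_poly lam)`_n = 1.
Proof. by have := monicP (monic_spec_poly lam); rewrite lead_coefE size_spec_poly. Qed.

Lemma coef_spec_poly1 lam : (0 < n)%N -> (spec_poly lam)`_n.-1 = \sum_k lam k.
Proof.
move=> n0; rewrite spec_polyE; set r := map _ _.
have szr : size r = n by rewrite size_map size_enum_ord.
rewrite -[X in _`_X.-1]szr coefPn_prod_XsubC ?szr ?gtn_eqF //.
by rewrite big_map big_enum /= sumrN opprK.
Qed.

Lemma coef_spec_minor lam k : (spec_minor lam k)`_n.-1 = 1.
Proof. by have := monicP (monic_spec_minor lam k); rewrite lead_coefE size_spec_minor. Qed.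

Lemma coef_spec_minor1 lam k : (1 < n)%N ->
  (spec_minor lam k)`_n.-2 = \sum_j lam j - lam k.
Proof.
move=> n1; rewrite -coef_spec_poly1 ?(ltnW n1) // (spec_polyD1 lam k).
have n2 : n.-1 = n.-2.+1 by case: n n1 => [|[|]].
by rewrite mulrDl coefD coefXM coefCM coef_spec_minor mulr1 addrK n2.
Qed.

Lemma lik_opD lam p q : lik_op lam (p + q) = lik_op lam p + lik_op lam q.
Proof. by rewrite /lik_op derivD !mulrDl !scalerDr; ring. Qed.

Lemma lik_opZ lam c p : lik_op lam (c *: p) = c *: lik_op lam p.
Proof.
by rewrite /lik_op derivZ scalerBr -!scalerAl !scalerA ![_ * c]mulrC.
Qed.

Lemma horner_lik_op lam p x : (lik_op lam p).[x] =
  n%:R * (p^`().[x] * (spec_poly lam).[x]) - n.-1%:R * (p.[x] * (spec_poly lam)^`().[x]).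
Proof. by rewrite hornerD hornerN !hornerZ !hornerM. Qed.

(** With D = (x + lam_k) Q one has D' = Q + (x + lam_k) Q', hence Q' D = Q (D' - Q), and Q factors
    out. *)
Lemma lik_op_minor lam k : (0 < n)%N ->
  lik_op lam (spec_minor lam k) =
  spec_minor lam k * ((spec_poly lam)^`() - n%:R *: spec_minor lam k).
Proof.
move=> n0; set Q := spec_minor lam k.
have DE : spec_poly lam = ('X + (lam k)%:P) * Q by exact: spec_polyD1.
have dDE : (spec_poly lam)^`() = Q + ('X + (lam k)%:P) * Q^`().
  by rewrite DE derivM derivD derivX derivC addr0 mul1r.
have nE : (n%:R : {poly K}) = n.-1%:R + 1 by rewrite natr1 prednK.
rewrite /lik_op -!mul_polyC !polyC_natr dDE DE nE; ring.
Qed.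

Lemma lik_polyE lam v : (0 < n)%N ->
  lik_poly lam v =
  \sum_k v k *: (spec_minor lam k * ((spec_poly lam)^`() - n%:R *: spec_minor lam k)).
Proof.
move=> n0; rewrite /lik_poly /data_poly.
rewrite (big_morph _ (lik_opD lam) (_ : lik_op lam 0 = 0)); last first.
  by rewrite /lik_op deriv0 !mul0r !scaler0 subr0.
by apply: eq_bigr => k _; rewrite lik_opZ lik_op_minor.
Qed.

Let cofactor lam k := (spec_poly lam)^`() - n%:R *: spec_minor lam k.

(** The terms of degree n - 1 of D' and n Q are equal and cancel; this is what bounds the degree of
    [lik_poly] by 2n - 3. *)
Let size_cofactor lam k : (1 < n)%N -> (size (cofactor lam k) <= n.-2.+1)%N.
Proof.
move=> n1; have n0 := ltnW n1; apply/leq_sizeP => j.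
rewrite -subn2 -subSn // subSS subn1 leq_eqVlt => /orP[/eqP <-|gtj].
  rewrite coefB coef_deriv prednK // coef_spec_poly coefZ coef_spec_minor.
  by rewrite mulr1 subrr.
have lej : (n <= j)%N by rewrite -(prednK n0).
rewrite nth_default // (leq_trans (size_polyD _ _)) // geq_max.
rewrite (leq_trans (size_deriv_spec_poly _)) //= size_polyN.
by rewrite (leq_trans (size_scale_leq _ _)) // size_spec_minor.
Qed.

Lemma size_lik_poly lam v : (1 < n)%N -> (size (lik_poly lam v) <= (2 * n).-2)%N.
Proof.
move=> n1; rewrite lik_polyE ?(ltnW n1) //.
apply: (leq_trans (size_sum _ _ _)); apply/bigmax_leqP => k _.
apply: (leq_trans (size_scale_leq _ _)); apply: (leq_trans (size_polyMleq _ _)).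
rewrite size_spec_minor; have := size_cofactor lam k n1; rewrite /cofactor.
move=> h; apply: (@leq_trans (n + n.-2.+1).-1).
  by rewrite -[X in (X <= _)%N]subn1 -[X in (_ <= X)%N]subn1
    leq_sub2r ?leq_add2l.
by case: n n1 => [|[|m]] // _; rewrite mul2n -addnn /= !addSn !addnS.
Qed.

(** The degree 2n - 3 splits as (n - 1) + (n - 2). There Q is monic, and D' - n Q contributes (n -
    1) S - n (S - lam_k), with S the sum of the eigenvalues. *)
Lemma coef_lik_poly lam v : (1 < n)%N ->
  (lik_poly lam v)`_(2 * n).-2.-1 = \sum_k v k * (n%:R * lam k - \sum_j lam j).
Proof.
move=> n1; have n0 := ltnW n1.
rewrite lik_polyE // coef_sum; apply: eq_bigr => k _.
have -> : (2 * n).-2.-1 = (n.-1 + n.-2)%N.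
  by case: n n1 => [|[|m]] // _; rewrite mul2n -addnn /= !addSn !addnS.
rewrite coefZ coefM_top ?size_cofactor //; last first.
  by rewrite size_spec_minor prednK.
rewrite coef_spec_minor mul1r coefB coef_deriv coefZ coef_spec_minor1 //.
have -> : n.-2.+1 = n.-1 by case: n n1 => [|[|]].
rewrite coef_spec_poly1 // -mulr_natr.
have -> : (n%:R : K) = n.-1%:R + 1 by rewrite natr1 prednK.
by congr (_ * _); ring.
Qed.

Lemma size_lik_crit lam v : (1 < n)%N -> (size (lik_crit lam v) <= 2 * n)%N.
Proof.
move=> n1; apply: (leq_trans (size_polyMleq _ _)).
rewrite size_XnsubC // addnS addn2 /=.
apply: (@leq_trans (2 * n).-2.+2); first by rewrite !ltnS size_lik_poly.
by case: n n1 => [|[|k]] // _; rewrite mul2n -addnn !addSn !addnS.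
Qed.

Lemma coef_lik_crit lam v : (1 < n)%N ->
  (lik_crit lam v)`_(2 * n).-1 = \sum_k v k * (n%:R * lam k - \sum_j lam j).
Proof.
move=> n1; rewrite -coef_lik_poly //.
have e : (2 * n).-1 = ((2 * n).-2.-1 + 2)%N.
  by case: n n1 => [|[|k]] // _; rewrite mul2n -addnn !addSn !addnS /= ?addn1 ?addn0.
rewrite [in LHS]e coefM_top ?size_XnsubC //; last first.
  rewrite (leq_trans (size_lik_poly _ _ n1)) //; exact: leqSpred.
have -> : ('X^2 - 4%:R%:P : {poly K})`_2 = 1 by rewrite coefB coefXn coefC subr0.
by rewrite mulr1.
Qed.

Lemma size_data_poly lam v : (size (data_poly lam v) <= n)%N.
Proof.
apply: (leq_trans (size_sum _ _ _)); apply/bigmax_leqP => k _.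
by rewrite (leq_trans (size_scale_leq _ _)) // size_spec_minor.
Qed.

Lemma coef_data_poly lam v : (data_poly lam v)`_n.-1 = \sum_k v k.
Proof.
rewrite coef_sum; apply: eq_bigr => k _.
by rewrite coefZ coef_spec_minor mulr1.
Qed.

Lemma horner_spec_poly lam x : (spec_poly lam).[x] = \prod_k (x + lam k).
Proof. by rewrite horner_prod; apply: eq_bigr => k _; rewrite !hornerE. Qed.

Lemma horner_spec_minor lam k x :
  (spec_minor lam k).[x] = \prod_(j | j != k) (x + lam j).
Proof. by rewrite horner_prod; apply: eq_bigr => j _; rewrite !hornerE. Qed.

Lemma horner_spec_minor0 lam k l :
  l != k -> (spec_minor lam l).[- lam k] = 0.
Proof.
move=> lk; rewrite horner_spec_minor (bigD1 k) 1?eq_sym //=.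
by rewrite addNr mul0r.
Qed.

Lemma horner_data_poly lam v k :
  (data_poly lam v).[- lam k] = v k * (spec_minor lam k).[- lam k].
Proof.
rewrite horner_sum (bigD1 k) //= big1 => [|l lk]; rewrite ?hornerZ ?addr0 //.
by rewrite horner_spec_minor0 // mulr0.
Qed.

End LikelihoodPoly.

(** * Compatibility of the critical polynomial with ring morphisms *)

Section MapLikelihoodPoly.
Variables (K L : comNzRingType) (f : {rmorphism K -> L}) (n : nat).
Implicit Types (lam v : 'I_n -> K).

Lemma map_spec_poly lam : map_poly f (spec_poly lam) = spec_poly (f \o lam).
Proof.
rewrite rmorph_prod /=; apply: eq_bigr => k _.
by rewrite rmorphD /= map_polyX map_polyC.
Qed.

Lemma map_spec_minor lam k :
  map_poly f (spec_minor lam k) = spec_minor (f \o lam) k.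
Proof.
rewrite rmorph_prod /=; apply: eq_bigr => j _.
by rewrite rmorphD /= map_polyX map_polyC.
Qed.

Lemma map_data_poly lam v :
  map_poly f (data_poly lam v) = data_poly (f \o lam) (f \o v).
Proof.
rewrite rmorph_sum /=; apply: eq_bigr => k _.
by rewrite map_polyZ /= map_spec_minor.
Qed.

Lemma map_lik_poly lam v :
  map_poly f (lik_poly lam v) = lik_poly (f \o lam) (f \o v).
Proof.
rewrite /lik_poly /lik_op rmorphB /= !map_polyZ /= !rmorphM /= -!deriv_map.
by rewrite map_spec_poly map_data_poly !rmorph_nat.
Qed.

Lemma map_lik_crit lam v :
  map_poly f (lik_crit lam v) = lik_crit (f \o lam) (f \o v).
Proof.
rewrite rmorphM /= map_lik_poly rmorphB /= map_polyXn map_polyC.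
by congr (_ * ('X^2 - _%:P)); exact: (rmorph_nat f 4).
Qed.

Lemma map_lik_disc lam v :
  map_poly f (lik_disc lam v) = lik_disc (f \o lam) (f \o v).
Proof.
by rewrite !rmorphM /= -deriv_map map_lik_crit map_spec_poly map_data_poly.
Qed.

End MapLikelihoodPoly.

(** * Complex data with separable critical polynomial *)

Lemma exists_nonroot (K : numDomainType) (p : {poly K}) : p != 0 -> exists c, p.[c] != 0.
Proof.
move=> p0; pose s := [seq k%:R : K | k <- iota 0 (size p)].
have us : uniq s by rewrite map_inj_uniq ?iota_uniq //; exact: mulrIn (oner_neq0 K).
have : ~~ all (root p) s.
  by apply/negP => /max_poly_roots /(_ us); rewrite size_map size_iota ltnn => /(_ p0).
by rewrite -has_predC => /hasP[c _ /=]; exists c.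
Qed.

(** A pair (a, b) stands for the condition a + c b != 0. The product of the corresponding non-zero
    polynomials in c has a non-root, which meets all conditions at once. *)
Lemma avoid_affine_zeros (K : numDomainType) (s : seq (K * K)) :
  all (fun ab => (ab.1 != 0) || (ab.2 != 0)) s ->
  exists c, all (fun ab => ab.1 + c * ab.2 != 0) s.
Proof.
move=> s0; pose p := \prod_(ab <- s) (ab.1%:P + ab.2 *: 'X).
have [|c pc] := @exists_nonroot K p.
  rewrite prodf_seq_neq0; apply: sub_all s0 => -[a b] /= ab.
  apply: contraTneq ab => /polyP e; have := e 0%N; have := e 1%N.
  by rewrite !(coefD, coefZ, coefC, coefX, coef0) /= mulr1 mulr0 addr0 add0r
    => -> ->; rewrite eqxx.
exists c; move: pc; rewrite horner_prod prodf_seq_neq0.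
by apply: sub_all => -[a b] /=; rewrite !hornerE mulrC.
Qed.

(** * Separable members of a pencil of polynomials *)

Section Pencil.
Variables (C : numClosedFieldType) (p q : {poly C}).

(** If p q' = p' q, coprimality makes p divide p', which is non-zero and of smaller degree. *)
Lemma wronskian_neq0 :
  coprimep p q -> (1 < size p)%N -> p * q^`() - p^`() * q != 0.
Proof.
move=> pq szp; apply/eqP => /eqP; rewrite subr_eq0 => /eqP e.
have dp0 : p^`() != 0.
  apply: contraTneq szp => dp0; have := congr1 (fun r : {poly C} => r`_(size p).-2) dp0.
  rewrite coef_deriv coef0 => /eqP; rewrite mulrn_eq0 /=.
  case szp : (size p) => [|[|m]] //=.
  by have := lead_coef_eq0 p; rewrite lead_coefE szp /= => -> /eqP p0;
     rewrite p0 size_poly0 in szp.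
have p0 : p != 0 by rewrite -size_poly_gt0 ltnW.
have : p %| p^`().
  by rewrite -(Gauss_dvdpl _ pq) -e dvdp_mulIl.
by move/dvdp_leq => /(_ dp0); rewrite leqNgt lt_size_deriv.
Qed.

(** At a multiple root p = - c q and p' = - c q', so the Wronskian vanishes there. Only its roots
    need to be kept from being roots of the chosen member. *)
Lemma pencil_separable c :
  coprimep p q ->
  (forall x, root (p * q^`() - p^`() * q) x -> p.[x] + c * q.[x] != 0) ->
  coprimep (p + c *: q) (p + c *: q)^`().
Proof.
move=> pq W; apply: Pdiv.ClosedField.root_coprimep => x rx.
apply: contraTneq (rx) => dx; rewrite rootE hornerD hornerZ W //.
move: rx dx; rewrite !rootE !(derivD, derivZ, hornerE) /=.
rewrite addr_eq0 => /eqP -> /eqP; rewrite addr_eq0 => /eqP ->.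
by apply/eqP; ring.
Qed.

End Pencil.

(** * Construction of the special data *)

Section SpecialData.
Variables (C : numClosedFieldType) (n : nat) (lam : 'I_n -> C).
Hypotheses (n_gt1 : (1 < n)%N) (lam_inj : injective lam).

Lemma spec_minor_neq0 k : (spec_minor lam k).[- lam k] != 0.
Proof.
rewrite horner_spec_minor; apply/prodf_neq0 => j jk.
by rewrite addrC subr_eq0 (inj_eq lam_inj).
Qed.

Lemma root_spec_poly x : root (spec_poly lam) x -> exists k, x = - lam k.
Proof.
rewrite rootE horner_spec_poly => /prodf_eq0[k _]; rewrite addr_eq0 => /eqP ->.
by exists k.
Qed.

Lemma deriv_spec_poly_neq0 k : (spec_poly lam)^`().[- lam k] != 0.
Proof.
rewrite (spec_polyD1 lam k) derivM derivD derivX derivC addr0 mul1r.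
by rewrite !hornerE addNr mul0r addr0 spec_minor_neq0.
Qed.

(** Lagrange interpolation at the n distinct nodes - lam_k. *)
Lemma data_poly_surj (p : {poly C}) : (size p <= n)%N -> exists v, data_poly lam v = p.
Proof.
move=> szp; pose v k := p.[- lam k] / (spec_minor lam k).[- lam k].
exists v; apply/eqP; rewrite -subr_eq0; apply/eqP.
apply: (@roots_geq_poly_eq0 _ _ [seq - lam k | k <- enum 'I_n]).
- apply/allP=> _ /mapP[k _ ->]; rewrite rootE hornerD hornerN horner_data_poly.
  by rewrite divfK ?subrr ?spec_minor_neq0.
- by rewrite map_inj_uniq ?enum_uniq // => k l /oppr_inj /lam_inj.
rewrite size_map size_enum_ord (leq_trans (size_polyD _ _)) // geq_max.
by rewrite size_data_poly size_polyN.
Qed.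

(** Writing p as a [data_poly], its two top coefficients are the sums of v_k and of v_k (S - lam_k),
    with S the sum of the eigenvalues; these determine the value of [coef_lik_poly]. *)
Lemma coef_lik_op (p : {poly C}) : (size p <= n)%N ->
  (lik_op lam p)`_(2 * n).-2.-1 =
  n.-1%:R * (\sum_k lam k) * p`_n.-1 - n%:R * p`_n.-2.
Proof.
move=> /data_poly_surj[v <-]; rewrite -/(lik_poly _ _) coef_lik_poly //.
rewrite coef_data_poly /data_poly coef_sum.
rewrite [X in _ = X - _]mulr_sumr [X in _ = _ - X]mulr_sumr -sumrB.
apply: eq_bigr => k _; rewrite coefZ coef_spec_minor1 //.
have -> : (n%:R : C) = n.-1%:R + 1 by rewrite natr1 prednK // ltnW.
by ring.
Qed.

Hypotheses (spec2 : (spec_poly lam).[2] != 0) (specN2 : (spec_poly lam).[- 2] != 0).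
Hypotheses (deriv2 : (spec_poly lam)^`().[2] != 0)
  (trace2 : \sum_k lam k + 2 * n%:R != 0).

Lemma exists_generic_data : exists v : 'I_n -> C,
  [/\ \sum_k v k != 0, (lik_crit lam v)`_(2 * n).-1 != 0 &
      coprimep (lik_crit lam v) (lik_disc lam v)].
Proof.
have n_gt0 := ltnW n_gt1.
set D := spec_poly lam; pose m := n.-1.
have m_gt0 : (0 < m)%N by rewrite /m -subn1 subn_gt0.
have nat_neq0 k : (0 < k)%N -> k%:R != 0 :> C by move=> k0; rewrite pnatr_eq0 gtn_eqF.
(* The derivative of [B] vanishes at most at 2, where 1 + c B takes the value 1; so N and N' share
   no root when c is non-zero. *)
pose B : {poly C} := ('X - 2%:P) ^+ m.
pose F0 := lik_op lam 1; pose F1 := lik_op lam B.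
have hB x : B.[x] = (x - 2) ^+ m by rewrite /B horner_exp !hornerE.
have dB : B^`() = ('X - 2%:P) ^+ m.-1 *+ m by rewrite deriv_exp derivXsubC mul1r.
have szB : size B = n by rewrite size_exp_XsubC prednK.
have B_top : B`_n.-1 = 1.
  have : lead_coef B = 1 by apply/monicP; rewrite monic_exp // monicXsubC.
  by rewrite lead_coefE szB.
have B_top1 : B`_n.-2 = - (2 * m%:R).
  have -> : B = \prod_(a <- nseq m 2) ('X - a%:P).
    by rewrite big_nseq iter_mulr_1.
  have := @coefPn_prod_XsubC C (nseq m 2); rewrite size_nseq /m => ->;
    last by rewrite gtn_eqF.
  by rewrite big_nseq iter_addr_0 mulr_natr.
have F1_top : F1`_(2 * n).-2.-1 != 0.
  rewrite coef_lik_op ?szB // B_top B_top1 mulr1.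
  have -> : n.-1%:R * \sum_k lam k - n%:R * - (2 * m%:R) =
    m%:R * (\sum_k lam k + 2 * n%:R) by rewrite /m; ring.
  by rewrite mulf_neq0 ?nat_neq0.
have F0E : F0 = - (m%:R *: D^`()) by rewrite /F0 /lik_op derivC mul0r scaler0 sub0r mul1r.
have hF0 x : F0.[x] = - (m%:R * D^`().[x]) by rewrite F0E !hornerE.
have hF1 x : F1.[x] = n%:R * (B^`().[x] * D.[x]) - m%:R * (B.[x] * D^`().[x]).
  exact: horner_lik_op.
have F01 : coprimep F0 F1.
  (* A root of F0 is a root of D', where F1 reduces to n B' D: D is non-zero there since its roots
     are simple, and B' since 2 is not a root of D'. *)
  apply: Pdiv.ClosedField.root_coprimep => x.
  rewrite rootE hF0 hF1 oppr_eq0 mulf_eq0 (negbTE (nat_neq0 _ m_gt0)) /= => /eqP dx.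
  rewrite dx !mulr0 subr0 !mulf_neq0 ?nat_neq0 //.
    rewrite dB hornerMn horner_exp !hornerE mulrn_eq0 negb_or -lt0n m_gt0 /=.
    apply: expf_neq0; rewrite subr_eq0; apply: contraTneq deriv2 => <-.
    by rewrite -/D dx eqxx.
  apply/negP => /root_spec_poly[k xk]; have := deriv_spec_poly_neq0 k.
  by rewrite -xk -/D dx eqxx.
have szF0 : (1 < size F0)%N.
  rewrite F0E size_polyN size_scale ?nat_neq0 //.
  apply: leq_trans n_gt1 _; rewrite leqNgt; apply/negP => lt.
  have : D^`()`_n.-1 = 0 by rewrite nth_default // -ltnS prednK.
  rewrite coef_deriv prednK // coef_spec_poly; apply/eqP; exact: nat_neq0.
pose W := F0 * F1^`() - F0^`() * F1.
have W0 : W != 0 by exact: wronskian_neq0.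
have [rW rWE] := closed_field_poly_normal W.
(* In order: c is non-zero, N(-2) is non-zero, the degree does not drop, F = F0 + c F1 does not
   vanish at 2, at -2 or at a root of the Wronskian, and N does not vanish at a root of D. *)
pose bad := (0, 1) :: (1, B.[- 2]) :: (F0`_(2 * n).-2.-1, F1`_(2 * n).-2.-1) ::
  [seq (F0.[x], F1.[x]) | x <- [:: 2, - 2 & rW]] ++
  [seq (1, B.[- lam k]) | k <- enum 'I_n].
have [|c] := @avoid_affine_zeros C bad.
  rewrite /= !oner_eq0 F1_top !orbT all_cat /=.
  have F01x x : (F0.[x] != 0) || (F1.[x] != 0).
    case: eqVneq => //= e; apply: (Pdiv.ClosedField.coprimepP _ _ F01).
    by rewrite rootE e.
  rewrite !F01x /=; apply/andP; split; first by apply/allP => _ /mapP[x _ ->] /=.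
  by apply/allP => _ /mapP[x _ ->]; rewrite oner_eq0.
rewrite /= all_cat => /and5P[c0 Nm2 F_top F2 /and3P[Fm2]].
rewrite add0r mulr1 in c0.
move=> /allP FW /allP ND; have [N NE] : exists N, N = 1 + c *: B by exists (1 + c *: B).
have hN x : N.[x] = 1 + c * B.[x] by rewrite NE hornerD hornerZ hornerC.
have szN : (size N <= n)%N.
  rewrite NE (leq_trans (size_polyD _ _)) // geq_max size_poly1 n_gt0 /=.
  by rewrite (leq_trans (size_scale_leq _ _)) // szB.
have [v vN] := data_poly_surj szN.
have FE : lik_poly lam v = F0 + c *: F1 by rewrite /lik_poly vN NE lik_opD lik_opZ.
exists v; split.
- rewrite -(coef_data_poly lam) vN NE coefD coefZ B_top mulr1 coef1 -/m (gtn_eqF m_gt0).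
  by rewrite add0r.
- by rewrite coef_lik_crit // -coef_lik_poly // FE coefD coefZ.
have FD : coprimep (lik_poly lam v) D.
  rewrite coprimep_sym; apply: Pdiv.ClosedField.root_coprimep => x rx.
  have [k xk] := root_spec_poly rx; rewrite /lik_poly vN horner_lik_op -/D.
  move/rootP: rx => ->; rewrite !mulr0 add0r oppr_eq0 !mulf_neq0 ?nat_neq0 //.
    rewrite hN; apply: (ND (1, B.[x])); rewrite xk; apply/mapP; exists k => //.
    by rewrite mem_enum.
  by rewrite xk deriv_spec_poly_neq0.
have FF : coprimep (lik_poly lam v) (lik_poly lam v)^`().
  rewrite FE; apply: pencil_separable => // x rx.
  apply: (FW (F0.[x], F1.[x])); apply/mapP; exists x => //.
  by move: rx; rewrite -/W rWE rootZ ?lead_coef_eq0 // root_prod_XsubC.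
have FN : coprimep (lik_poly lam v) N.
  (* At a common root F reduces to n N' D, so N' vanishes too; this forces x = 2, where N is 1. *)
  apply: Pdiv.ClosedField.root_coprimep => x rx; apply/negP => /eqP.
  move=> Nx; move: (rx); rewrite /lik_poly vN rootE horner_lik_op.
  rewrite Nx mul0r mulr0 subr0.
  have Dx : D.[x] != 0 by apply: (Pdiv.ClosedField.coprimepP _ _ FD).
  rewrite !mulf_eq0 (negbTE Dx) (negbTE (nat_neq0 _ n_gt0)) orbF /=.
  rewrite NE derivD derivC add0r derivZ hornerZ mulf_eq0 (negbTE c0) /=.
  rewrite dB hornerMn horner_exp !hornerE mulrn_eq0 gtn_eqF //=.
  rewrite expf_eq0 => /andP[_ /eqP x2].
  move: Nx; rewrite hN hB x2 expr0n gtn_eqF // mulr0 addr0 => /eqP.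
  by rewrite oner_eq0.
pose X4 : {poly C} := 'X^2 - 4%:R%:P.
have X4P (p : {poly C}) : p.[2] != 0 -> p.[- 2] != 0 -> coprimep X4 p.
  move=> p2 pN2; apply: Pdiv.ClosedField.root_coprimep => x.
  move=> /rootP h; have /eqP : x ^+ 2 = 2 ^+ 2.
    by apply/eqP; rewrite -subr_eq0 -natrX -h !hornerE.
  by rewrite eqf_sqr => /orP[] /eqP ->.
have FX4 : coprimep (lik_poly lam v) X4.
  by rewrite coprimep_sym X4P // FE hornerD hornerZ.
have sepX4 : separable_poly X4.
  rewrite separable_poly.unlock X4P // /X4 derivB derivXn derivC subr0 hornerMn hornerX.
    by rewrite mulrn_eq0 /= pnatr_eq0.
  by rewrite mulrn_eq0 oppr_eq0 /= pnatr_eq0.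
have : separable_poly (lik_crit lam v).
  by rewrite separable_mul sepX4 FX4 separable_poly.unlock FF.
rewrite separable_poly.unlock /lik_disc vN !coprimepMr => ->.
rewrite !coprimepMl FD FN /= !X4P //.
by rewrite hN hB subrr expr0n gtn_eqF // mulr0 addr0 oner_eq0.
by rewrite hN.
Qed.

End SpecialData.

(** * Counting solutions *)

Section PartialFractions.
Variables (K : fieldType) (n : nat) (lam v : 'I_n -> K) (x : K).
Hypothesis Dx : (spec_poly lam).[x] != 0.

Lemma spec_factor_neq0 k : x + lam k != 0.
Proof. by move: Dx; rewrite horner_spec_poly => /prodf_neq0 /(_ k isT). Qed.

Lemma horner_spec_minorE k :
  (spec_minor lam k).[x] = (spec_poly lam).[x] / (x + lam k).
Proof.
rewrite (spec_polyD1 lam k) hornerM hornerD hornerX hornerC mulrAC divff ?mul1r //.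
exact: spec_factor_neq0.
Qed.

Lemma horner_data_polyE :
  (data_poly lam v).[x] = (spec_poly lam).[x] * \sum_k v k / (x + lam k).
Proof.
rewrite horner_sum mulr_sumr; apply: eq_bigr => k _.
by rewrite hornerZ horner_spec_minorE mulrCA.
Qed.

(** Dividing by D^2 turns minors into 1 / (x + lam_k) and D' / D into their sum, which is the form
    in which the scores appear. *)
Lemma horner_lik_polyE : (0 < n)%N ->
  (lik_poly lam v).[x] = (spec_poly lam).[x] ^+ 2 *
    ((\sum_k v k / (x + lam k)) * (\sum_k (x + lam k)^-1) -
     n%:R * \sum_k v k / (x + lam k) ^+ 2).
Proof.
move=> n0; rewrite lik_polyE // horner_sum.
have -> : (spec_poly lam)^`() = \sum_k spec_minor lam k by exact: deriv_spec_poly.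
set S1 := \sum_k (x + lam k)^-1.
rewrite mulr_suml [X in _ - X]mulr_sumr -sumrB mulr_sumr.
apply: eq_bigr => k _; rewrite hornerZ hornerM hornerD hornerN hornerZ horner_sum.
have -> : \sum_j (spec_minor lam j).[x] = (spec_poly lam).[x] * S1.
  by rewrite mulr_sumr; apply: eq_bigr => j _; rewrite horner_spec_minorE.
by rewrite horner_spec_minorE; have := spec_factor_neq0 k => ?; field.
Qed.

End PartialFractions.

Lemma solution_count_arith n : (1 < n)%N -> ((2 * n - 3) * 4 + 4 = 8 * (n - 1))%N.
Proof. lia. Qed.

(** * Solutions of the score equations and roots of the critical polynomial *)

Section Count.
Variables (C : numClosedFieldType) (n : nat) (lam v : 'I_n -> C).
Hypothesis n_gt1 : (1 < n)%N.
Hypothesis crit_top : (lik_crit lam v)`_(2 * n).-1 != 0.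
Hypothesis crit_coprime : coprimep (lik_crit lam v) (lik_disc lam v).

(** The likelihood equations in the eigenbasis: [d k] runs through the eigenvalues of the covariance
    matrix, so the first clause says that its determinant is non-zero. *)
Definition score_eqs (a : C * C) :=
  let d k := a.1 ^+ 2 + a.2 ^+ 2 + a.1 * a.2 * lam k in
  [/\ forall k, d k != 0,
      \sum_k (2 * a.1 + a.2 * lam k) * (v k / d k ^+ 2 - (d k)^-1) = 0 &
      \sum_k (2 * a.2 + a.1 * lam k) * (v k / d k ^+ 2 - (d k)^-1) = 0].

(** The value of t = a_0 a_1 that the equation s A + t B = 0 forces at the ratio x = s / t. *)
Let r x := (data_poly lam v).[x] / (n%:R * (spec_poly lam).[x]).

Let n_neq0 : n%:R != 0 :> C.
Proof. by rewrite pnatr_eq0 -lt0n ltnW. Qed.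

Let critE x : (lik_crit lam v).[x] = (lik_poly lam v).[x] * (x ^+ 2 - 4).
Proof.
rewrite /lik_crit hornerM; congr (_ * _).
by rewrite hornerD hornerN hornerXn hornerC.
Qed.

Let spec_neq0 x : root (lik_crit lam v) x -> (spec_poly lam).[x] != 0.
Proof.
move=> rx; have := Pdiv.ClosedField.coprimepP _ _ crit_coprime x rx.
by rewrite !hornerM !mulf_eq0 !negb_or => /andP[/andP[]].
Qed.

Let data_neq0 x : root (lik_crit lam v) x -> (data_poly lam v).[x] != 0.
Proof.
move=> rx; have := Pdiv.ClosedField.coprimepP _ _ crit_coprime x rx.
by rewrite !hornerM !mulf_eq0 !negb_or => /andP[_].
Qed.

Let r_neq0 x : root (lik_crit lam v) x -> r x != 0.
Proof.
move=> rx; rewrite /r mulf_neq0 ?data_neq0 // invr_eq0 mulf_neq0 ?n_neq0 //.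
exact: spec_neq0.
Qed.

Lemma score_eqsP a :
  score_eqs a <-> exists x, [/\ root (lik_crit lam v) x,
    a.1 * a.2 = r x & a.1 ^+ 2 + a.2 ^+ 2 = r x * x].
Proof.
case: a => a b; rewrite /score_eqs /=.
set s := a ^+ 2 + b ^+ 2; set t := a * b; pose d k := s + t * lam k.
pose A := \sum_k (v k / d k ^+ 2 - (d k)^-1).
pose B := \sum_k lam k * (v k / d k ^+ 2 - (d k)^-1).
have scE p q : \sum_k (p + q * lam k) * (v k / d k ^+ 2 - (d k)^-1) = p * A + q * B.
  by rewrite /A /B !mulr_sumr -big_split; apply: eq_bigr => k _ /=; ring.
rewrite !scE.
have n_gt0 := ltnW n_gt1.
(* Euler's identity for the scaling of (s, t): the weight s + t lam_k is [d k] itself and cancels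
   one denominator. *)
have euler : (forall k, d k != 0) -> s * A + t * B = \sum_k v k / d k - n%:R.
  move=> d0; rewrite -scE -[n in n%:R](card_ord n) -sumr_const -sumrB.
  by apply: eq_bigr => k _; have := d0 k; rewrite /d => ?; field.
have main x : t != 0 -> s = t * x -> (forall k, d k != 0) ->
    [/\ (spec_poly lam).[x] != 0, \sum_k v k / d k = n%:R * r x / t &
     \sum_k v k / d k = n%:R ->
       (lik_poly lam v).[x] = - (n%:R * t ^+ 2 * (spec_poly lam).[x] ^+ 2) * A].
  move=> t0 sx d0; have dE k : d k = t * (x + lam k) by rewrite /d sx; ring.
  have x0 k : x + lam k != 0 by have := d0 k; rewrite dE mulf_eq0 negb_or => /andP[].
  have D0 : (spec_poly lam).[x] != 0.
    by rewrite horner_spec_poly; apply/prodf_neq0.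
  have V1 : \sum_k v k / d k = (\sum_k v k / (x + lam k)) / t.
    rewrite mulr_suml; apply: eq_bigr => k _; rewrite dE; have := x0 k => ?.
    by field; apply/andP.
  split=> //; first by rewrite V1 /r horner_data_polyE //; field; apply/and3P.
  move=> Vn; rewrite horner_lik_polyE //.
  have -> : \sum_k v k / (x + lam k) = n%:R * t by rewrite -Vn V1 divfK.
  have -> : A = (\sum_k v k / (x + lam k) ^+ 2) / t ^+ 2 - (\sum_k (x + lam k)^-1) / t.
    rewrite !mulr_suml -sumrB; apply: eq_bigr => k _; rewrite dE.
    by have := x0 k => ?; field; apply/andP.
  by field.
split.
  case=> d0 e1 e2.
  (* The combinations a e1 + b e2, a e1 - b e2 and a e2 - b e1 of the two scores are 2 (s A + t B),
     2 (a^2 - b^2) A and (a^2 - b^2) B. *)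
  have ab0 : a * (2 * a * A + b * B) + b * (2 * b * A + a * B) = 0.
    by rewrite e1 e2 !mulr0 addr0.
  have sAB : \sum_k v k / d k = n%:R.
    apply/eqP; rewrite -subr_eq0 -euler //; apply/eqP.
    have /(mulfI _) : 2 * (s * A + t * B) = 2 * 0.
      by rewrite mulr0 -ab0 /s /t; ring.
    by apply; rewrite pnatr_eq0.
  have abA : (a ^+ 2 - b ^+ 2) * A = 0.
    have /(mulfI _) : 2 * ((a ^+ 2 - b ^+ 2) * A) = 2 * 0.
      transitivity (a * (2 * a * A + b * B) - b * (2 * b * A + a * B)); first by ring.
      by rewrite e1 e2 !mulr0 subrr.
    by apply; rewrite pnatr_eq0.
  have abB : (a ^+ 2 - b ^+ 2) * B = 0.
    transitivity (a * (2 * b * A + a * B) - b * (2 * a * A + b * B)); first by ring.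
    by rewrite e1 e2 !mulr0 subrr.
  (* If t = 0, one parameter vanishes, so a^2 - b^2 is s or - s, hence non-zero, and A = B = 0. As
     every [d k] is then s, the sum of v_k is n s and that of v_k lam_k is s times the sum of the
     lam_k, which kills the top coefficient of [lik_crit]. *)
  have t0 : t != 0.
    apply/eqP => t0; have dE k : d k = s by rewrite /d t0 mul0r addr0.
    have s0 : s != 0 by have : d (Ordinal n_gt0) != 0 := d0 _; rewrite dE.
    have u0 : a ^+ 2 - b ^+ 2 != 0.
      apply/eqP => u0; case/eqP: s0; rewrite /s.
      move/eqP: t0; rewrite mulf_eq0 => /orP[]/eqP z; move: u0; rewrite z expr0n /=.
        by rewrite sub0r add0r => /eqP; rewrite oppr_eq0 => /eqP.
      by rewrite subr0 addr0.
    move: abA abB => /(canRL (mulKf u0)) A0 /(canRL (mulKf u0)) B0.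
    rewrite mulr0 in A0; rewrite mulr0 in B0.
    case/eqP: crit_top; rewrite coef_lik_crit //.
    have E1 : \sum_k v k = n%:R * s.
      by rewrite -sAB mulr_suml; apply: eq_bigr => k _; rewrite dE divfK.
    have E2 : \sum_k v k * lam k = (\sum_k lam k) * s.
      apply/eqP; rewrite -subr_eq0 mulr_suml -sumrB; apply/eqP.
      transitivity (s ^+ 2 * B); last by rewrite B0 mulr0.
      by rewrite mulr_sumr; apply: eq_bigr => k _; rewrite dE; field.
    transitivity (n%:R * (\sum_k v k * lam k) - (\sum_k v k) * (\sum_k lam k)).
      rewrite mulr_suml mulr_sumr -sumrB; apply: eq_bigr => k _; ring.
    by rewrite E1 E2; ring.
  have sx : s = t * (s / t) by rewrite mulrC divfK.
  exists (s / t); have [D0 V1 V2] := main _ t0 sx d0.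
  have rt : r (s / t) = t.
    move: V1; rewrite sAB => /esym /(canRL (divfK t0)).
    by move/(mulfI n_neq0).
  split=> //; last by rewrite rt.
  rewrite rootE critE V2 //.
  have -> : (s / t) ^+ 2 - 4 = ((a ^+ 2 - b ^+ 2) / t) ^+ 2.
    have : s ^+ 2 - 4 * t ^+ 2 = (a ^+ 2 - b ^+ 2) ^+ 2 by rewrite /s /t; ring.
    move=> h; transitivity ((s ^+ 2 - 4 * t ^+ 2) / t ^+ 2); first by field.
    by rewrite h; field.
  apply/eqP; transitivity (- (n%:R * (spec_poly lam).[s / t] ^+ 2) *
     ((a ^+ 2 - b ^+ 2) * A) * (a ^+ 2 - b ^+ 2)); first by field.
  by rewrite abA mulr0 mul0r.
case=> x [rx tE sE].
have t0 : t != 0 by rewrite tE r_neq0.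
have sx : s = t * x by rewrite sE tE.
have d0 k : d k != 0.
  rewrite /d sx -mulrDr mulf_neq0 //; exact: spec_factor_neq0 (spec_neq0 rx) k.
have [D0 V1 V2] := main _ t0 sx d0.
have sAB : \sum_k v k / d k = n%:R by rewrite V1 -tE mulfK.
have e1 : s * A + t * B = 0 by rewrite euler // sAB subrr.
have e2 : (a ^+ 2 - b ^+ 2) * A = 0.
  move: rx; rewrite rootE critE V2 // => /eqP h.
  (* The factor x^2 - 4 yields the square of a^2 - b^2; in a field one power suffices for the
     conclusion. *)
  have : (a ^+ 2 - b ^+ 2) ^+ 2 * A = 0.
    have /(mulfI _) : n%:R * (spec_poly lam).[x] ^+ 2 * ((a ^+ 2 - b ^+ 2) ^+ 2 * A) =
        n%:R * (spec_poly lam).[x] ^+ 2 * 0.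
      have -> : (a ^+ 2 - b ^+ 2) ^+ 2 = t ^+ 2 * (x ^+ 2 - 4).
        transitivity (s ^+ 2 - 4 * t ^+ 2); first by rewrite /s /t; ring.
        by rewrite sx; ring.
      by rewrite mulr0 -[RHS]oppr0 -h; ring.
    by apply; rewrite mulf_neq0 ?expf_neq0.
  move/eqP; rewrite mulf_eq0 expf_eq0 /= => /orP[]/eqP ->; rewrite ?mul0r ?mulr0 //.
(* Multiplied by a and by b, the two scores become s A + t B plus or minus (a^2 - b^2) A; since t is
   non-zero, a and b can be cancelled. *)
have [a0 b0] : a != 0 /\ b != 0 by apply/andP; rewrite -negb_or -mulf_eq0.
split=> //.
  apply: (mulfI a0); rewrite mulr0.
  transitivity (s * A + t * B + (a ^+ 2 - b ^+ 2) * A); first by rewrite /s /t; ring.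
  by rewrite e1 e2 addr0.
apply: (mulfI b0); rewrite mulr0.
transitivity (s * A + t * B - (a ^+ 2 - b ^+ 2) * A); first by rewrite /s /t; ring.
by rewrite e1 e2 subr0.
Qed.


(** The top coefficient gives degree exactly 2n - 1, and coprimality with the derivative makes the
    roots simple; setting 2 and -2 aside leaves 2n - 3. *)
Let crit_roots : exists rs : seq C, [/\ uniq rs, size rs = (2 * n - 3)%N,
  {in rs, forall x, x ^+ 2 != 4} &
  forall x, root (lik_crit lam v) x = (x \in [:: 2, - 2 & rs])].
Proof.
have n2_gt0 : (0 < 2 * n)%N by rewrite muln_gt0 (ltnW n_gt1).
have szE : size (lik_crit lam v) = (2 * n)%N.
  apply/eqP; rewrite eqn_leq size_lik_crit //= -[X in (X <= _)%N](prednK n2_gt0).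
  by rewrite ltnNge; apply: contra crit_top => le; rewrite nth_default.
have E0 : lik_crit lam v != 0 by rewrite -size_poly_gt0 szE.
have [rE rEE] := closed_field_poly_normal (lik_crit lam v).
have memE x : root (lik_crit lam v) x = (x \in rE).
  by rewrite rEE rootZ ?lead_coef_eq0 // root_prod_XsubC.
have uE : uniq rE.
  rewrite -separable_prod_XsubC.
  have : separable_poly (lik_crit lam v).
    by move: crit_coprime; rewrite separable_poly.unlock !coprimepMr => /andP[/andP[]].
  by apply: dvdp_separable; rewrite [X in _ %| X]rEE dvdpZr ?lead_coef_eq0.
have sE : size rE = (2 * n).-1.
  by have := szE; rewrite rEE size_scale ?lead_coef_eq0 // size_prod_XsubC => <-.
have pm2 x : x ^+ 2 = 4 -> x \in rE by move=> e; rewrite -memE rootE critE e subrr mulr0.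
have e2 : 2 \in rE by apply: pm2; rewrite -natrX.
have two_neq : - 2 != 2 :> C.
  by rewrite -subr_eq0 -opprD oppr_eq0 -natrD pnatr_eq0.
have eN2 : - 2 \in rem 2 rE.
  by rewrite mem_rem_uniq // !inE two_neq pm2 // sqrrN -natrX.
exists (rem (- 2) (rem 2 rE)); split.
- by rewrite !rem_uniq.
- rewrite size_rem // size_rem // sE; case: n n_gt1 => [|[|k]] // _.
  by rewrite mul2n -addnn !addSn !addnS.
- move=> x; rewrite mem_rem_uniq ?rem_uniq // inE mem_rem_uniq // => /and3P[xN x2 _].
  by rewrite (_ : 4 = 2 ^+ 2) ?eqf_sqr ?negb_or ?x2 // -natrX.
move=> x; rewrite memE (perm_mem (perm_to_rem e2)) !inE; congr (_ || _).
by rewrite (perm_mem (perm_to_rem eN2)) !inE.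
Qed.

(** Square roots giving a_0 + a_1 and a_0 - a_1 up to sign, as their squares are s + 2t = t (x + 2)
    and s - 2t = t (x - 2). *)
Let al x := sqrtC (r x * (x + 2)).
Let be x := sqrtC (r x * (x - 2)).
Let signs : seq (C * C) := [:: (1, 1); (1, -1); (-1, 1); (-1, -1)].

Let signs_sqr e : e \in signs -> e.1 ^+ 2 = 1 /\ e.2 ^+ 2 = 1.
Proof. by rewrite !inE => /or4P[]/eqP ->; rewrite /= ?sqrrN ?expr1n. Qed.

Let mem_signs e : e.1 ^+ 2 = 1 -> e.2 ^+ 2 = 1 -> e \in signs.
Proof.
case: e => a b /= /eqP; rewrite sqrf_eq1 => /orP[]/eqP-> /eqP;
  by rewrite sqrf_eq1 => /orP[]/eqP->; rewrite !inE eqxx ?orbT.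
Qed.

(* In the coordinates [a_0 + a_1] and [a_0 - a_1] every critical ratio
   [x = s / t] other than 2 and -2 gives four solutions, and these two only
   give two each. *)
Lemma score_eqs_count : exists s : seq (C * C),
  [/\ uniq s, size s = (8 * (n - 1))%N & forall a, a \in s <-> score_eqs a].
Proof.
have [rs [urs srs rsN4 rootE']] := crit_roots.
have two_neq0 : 2 != 0 :> C by rewrite pnatr_eq0.
have r0 x : x \in [:: 2, - 2 & rs] -> r x != 0 by rewrite -rootE'; apply: r_neq0.
have in2 : 2 \in [:: 2, - 2 & rs] by rewrite inE eqxx.
have inN2 : - 2 \in [:: 2, - 2 & rs] by rewrite !inE eqxx orbT.
have in_rs x : x \in rs -> x \in [:: 2, - 2 & rs] by rewrite !inE => ->; rewrite !orbT.
have al2 : al 2 != 0 by rewrite sqrtC_eq0 mulf_neq0 ?r0 // -natrD pnatr_eq0.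
have be2 : be (- 2) != 0.
  by rewrite sqrtC_eq0 mulf_neq0 ?r0 // -opprD oppr_eq0 -natrD pnatr_eq0.
have ab0 x : x \in rs -> (al x != 0) /\ (be x != 0).
  move=> xrs; have := rsN4 _ xrs; have rx := r0 _ (in_rs _ xrs).
  rewrite (_ : 4 = 2 ^+ 2) -?natrX // natrX eqf_sqr negb_or => /andP[x2 xN2].
  by split; rewrite sqrtC_eq0 mulf_neq0 // (subr_eq0, addr_eq0).
pose L := [:: (al 2, 0); (- al 2, 0); (0, be (- 2)); (0, - be (- 2))] ++
  [seq (e.1 * al x, e.2 * be x) | x <- rs, e <- signs].
pose mk (pq : C * C) := ((pq.1 + pq.2) / 2, (pq.1 - pq.2) / 2).
have mkK : cancel mk (fun a => (a.1 + a.2, a.1 - a.2)).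
  by case=> p q; rewrite /mk /=; congr (_, _); field.
have Kmk : cancel (fun a : C * C => (a.1 + a.2, a.1 - a.2)) mk.
  by case=> p q; rewrite /mk /=; congr (_, _); field.
have alK x : al x ^+ 2 = r x * (x + 2) by rewrite sqrtCK.
have beK x : be x ^+ 2 = r x * (x - 2) by rewrite sqrtCK.
have memL p q : (p, q) \in L <-> exists2 x, x \in [:: 2, - 2 & rs] &
    p ^+ 2 = r x * (x + 2) /\ q ^+ 2 = r x * (x - 2).
  split.
    rewrite mem_cat => /orP[|/allpairsP[[x e] [/= xrs es [-> ->]]]]; last first.
      exists x; first exact: in_rs.
      by have [e1 e2] := signs_sqr es; rewrite !exprMn e1 e2 !mul1r alK beK.
    rewrite !inE => /or4P[]/eqP[-> ->]; [exists 2|exists 2|exists (-2)|exists (-2)] => //;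
      by rewrite ?sqrrN sqrtCK ?subrr ?addNr mulr0 expr0n.
  case=> x xin [p2 q2].
  have /or3P[/eqP xE|/eqP xE|xrs] : [|| x == 2, x == - 2 | x \in rs].
    by move: xin; rewrite !inE.
  - move: p2 q2; rewrite xE subrr mulr0 -alK => p2 /eqP; rewrite expf_eq0 /= => /eqP ->.
    move: p2 => /eqP; rewrite eqf_sqr => /orP[]/eqP->;
      by rewrite mem_cat !inE eqxx ?orbT.
  - move: q2 p2; rewrite xE addNr mulr0 -beK => q2 /eqP; rewrite expf_eq0 /= => /eqP ->.
    move: q2 => /eqP; rewrite eqf_sqr => /orP[]/eqP->;
      by rewrite mem_cat !inE eqxx ?orbT.
  have [a0 b0] := ab0 _ xrs.
  rewrite mem_cat; apply/orP; right; apply/allpairsP.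
  exists (x, (p / al x, q / be x)); split=> //=; last by rewrite !divfK.
  by apply: mem_signs; rewrite /= expr_div_n ?p2 ?q2 -?alK -?beK divff // expf_neq0.
have uL : uniq L.
  have NE (a : C) : a != 0 -> (a == - a) = false.
    by move=> a0; apply/negbTE; rewrite -addr_eq0 -mulr2n mulrn_eq0.
  rewrite cat_uniq; apply/and3P; split.
  - rewrite /= !inE !xpair_eqE !NE // !andbT !eqxx ?oppr_eq0.
    by rewrite (negbTE al2).
  - apply/hasPn => _ /allpairsP[[x e] [/= xrs es ->]].
    have [a0 b0] := ab0 _ xrs; have [e1 e2] := signs_sqr es.
    have e10 : e.1 != 0 by apply: contra_eq_neq e1 => ->; rewrite expr0n eq_sym oner_neq0.
    have e20 : e.2 != 0 by apply: contra_eq_neq e2 => ->; rewrite expr0n eq_sym oner_neq0.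
    by rewrite !inE !xpair_eqE !mulf_eq0 (negbTE e10)
      (negbTE e20) (negbTE a0) (negbTE b0) !andbF.
  apply: allpairs_uniq => //.
    have N11 : 1 != -1 :> C by rewrite NE ?oner_neq0.
    by rewrite /= !inE !xpair_eqE !eqxx (negbTE N11) eq_sym (negbTE N11).
  move=> _ _ /allpairsP[[x e] [xrs es ->]] /allpairsP[[y f] [yrs fs ->]] /= [E1 E2].
  have [e1 e2] := signs_sqr es; have [f1 f2] := signs_sqr fs.
  have P : r x * (x + 2) = r y * (y + 2).
    by have := congr1 (fun z => z ^+ 2) E1; rewrite /= !exprMn e1 f1 !mul1r ?alK ?beK.
  have Q : r x * (x - 2) = r y * (y - 2).
    by have := congr1 (fun z => z ^+ 2) E2; rewrite /= !exprMn e2 f2 !mul1r ?alK ?beK.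
  (* The squares of the two coordinates determine r(x), as their difference is 4 r(x), and then x;
     the signs follow because neither square root is zero. *)
  have rxy : r x = r y.
    have /(mulfI _) : 4 * r x = 4 * r y.
      transitivity (r x * (x + 2) - r x * (x - 2)); first by ring.
      by rewrite P Q; ring.
    by apply; rewrite pnatr_eq0.
  have xy : x = y.
    by move: P; rewrite rxy => /(mulfI (r0 _ (in_rs _ yrs))) /addIr.
  have [a0 b0] := ab0 _ yrs.
  move: E1 E2; rewrite xy => /(mulIf a0) E1 /(mulIf b0) E2.
  by rewrite [e]surjective_pairing E1 E2 -surjective_pairing.
exists (map mk L); split.
- by rewrite (map_inj_uniq (can_inj mkK)).
- rewrite size_map size_cat size_allpairs srs /=.
  by rewrite addnC solution_count_arith.
move=> a; rewrite score_eqsP -[a in a \in _]Kmk (mem_map (can_inj mkK)) memL.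
split.
  case=> x xr [p2 q2]; exists x; rewrite rootE'; split=> //.
    have /(mulfI _) : 4 * (a.1 * a.2) = 4 * r x.
      transitivity ((a.1 + a.2) ^+ 2 - (a.1 - a.2) ^+ 2); first by ring.
      by rewrite p2 q2; ring.
    by apply; rewrite pnatr_eq0.
  have /(mulfI two_neq0) // : 2 * (a.1 ^+ 2 + a.2 ^+ 2) = 2 * (r x * x).
  transitivity ((a.1 + a.2) ^+ 2 + (a.1 - a.2) ^+ 2); first by ring.
  by rewrite p2 q2; ring.
case=> x [xr tE sE]; exists x; rewrite -?rootE' //; split.
  transitivity ((a.1 ^+ 2 + a.2 ^+ 2) + 2 * (a.1 * a.2)); first by ring.
  by rewrite tE sE; ring.
transitivity ((a.1 ^+ 2 + a.2 ^+ 2) - 2 * (a.1 * a.2)); first by ring.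
by rewrite tE sE; ring.
Qed.

End Count.

(** * The scores in the eigenbasis *)

Lemma ord2_cases (i : 'I_2) : i = 0 \/ i = 1.
Proof. by case: i => [[|[|//]] ?]; [left|right]; apply: val_inj. Qed.

Lemma MA1_covE (K : comNzRingType) n (a : 'I_2 -> K) :
  MA1_cov n a = (a 0 ^+ 2 + a 1 ^+ 2)%:M + (a 0 * a 1) *: path_mx K n.
Proof.
apply/matrixP=> i j; rewrite !mxE; have [->|ij] := eqVneq i j.
  by rewrite gtn_eqF // mulr0 addr0.
by case: ifP; rewrite ?mulr1 ?mulr0 mulr0n add0r.
Qed.

(** Addition in ['I_2] is modulo 2, so [a (i + 1)] is the other parameter. *)
Lemma MA1_dcovE (K : comNzRingType) n (i : 'I_2) (a : 'I_2 -> K) :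
  MA1_dcov n i a = (2 * a i)%:M + a (i + 1) *: path_mx K n.
Proof.
have X2 (j k : 'I_2) : ('X_j : {mpoly K[2]})^`M(k) = (j == k)%:R.
  rewrite mderivX mnm1E; case: eqP => [->|_]; last by rewrite scale0r.
  rewrite (_ : _ - _ = 0)%MM ?mpolyX0 ?scale1r //; apply/mnmP => l.
  by rewrite mnmBE mnm0E subnn.
apply/matrixP=> k l; rewrite [LHS]mxE MA1_covE !mxE.
rewrite mderivD mderivM mderivMn mderivD !expr2 !mderivM !X2.
have -> : forall b, ((b%:R : {mpoly K[2]})^`M(i)) = 0.
  by move=> b; rewrite -mpolyC_nat mderivC.
rewrite mulr0 addr0 !(mevalD, mevalM, mevalMn, mevalXU, meval1) /=.
have [->|->] := ord2_cases i.
- rewrite !eqxx add0r /=; case: (k == l); case: (_ || _); rewrite /=; ring.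
- have -> : (1 + 1 : 'I_2) = 0 by apply: val_inj.
  rewrite !eqxx /=; case: (k == l); case: (_ || _); rewrite /=; ring.
Qed.

Section Diagonalisation.
Variables (K : fieldType) (n : nat) (U : 'M[K]_n) (lam : 'I_n -> K).
Hypothesis UU : U *m U^T = 1%:M.
Hypothesis path_diag : path_mx K n = U^T *m diag_mx (\row_k lam k) *m U.

(** The covariance matrix, its derivatives and its inverse all have this form, so trace and
    quadratic form become sums over the eigenvalues. *)
Let dg (d : 'I_n -> K) := U^T *m diag_mx (\row_k d k) *m U.

Let dgM d e : dg d *m dg e = dg (fun k => d k * e k).
Proof.
rewrite /dg !mulmxA; congr (_ *m _); rewrite -!mulmxA; congr (_ *m _).
rewrite (mulmxA U) UU mul1mx mulmx_diag; congr diag_mx.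
by apply/rowP=> k; rewrite !mxE.
Qed.

Let dg1 : dg (fun _ => 1) = 1%:M.
Proof.
rewrite /dg (_ : \row_k _ = const_mx 1) ?diag_const_mx ?mulmx1 ?(mulmx1C UU) //.
by apply/rowP=> k; rewrite !mxE.
Qed.

Let dg_lin s t : s%:M + t *: path_mx K n = dg (fun k => s + t * lam k).
Proof.
rewrite path_diag -(scalemx1 _ s) -dg1 /dg.
have -> : diag_mx (\row_k (s + t * lam k)) =
    s *: diag_mx (\row_(k < n) 1) + t *: diag_mx (\row_k lam k).
  rewrite -!linearZ -linearD /=; congr diag_mx; apply/rowP=> k.
  by rewrite !mxE mulr1.
by rewrite mulmxDr mulmxDl -!scalemxAr -!scalemxAl.
Qed.

Let det_dg d : \det (dg d) = \prod_k d k.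
Proof.
rewrite /dg !det_mulmx mulrAC -det_mulmx (mulmx1C UU) det1 mul1r det_diag.
by apply: eq_bigr => k _; rewrite mxE.
Qed.

Let tr_dg d : \tr (dg d) = \sum_k d k.
Proof.
rewrite /dg mxtrace_mulC mulmxA UU mul1mx mxtrace_diag.
by apply: eq_bigr => k _; rewrite mxE.
Qed.

Let quad_dg d (y : 'cV_n) : (y^T *m dg d *m y) 0 0 = \sum_k d k * (U *m y) k 0 ^+ 2.
Proof.
rewrite /dg !mulmxA -trmx_mul -mulmxA mul_mx_diag mxE.
by apply: eq_bigr => k _; rewrite !mxE mulrAC mulrC expr2.
Qed.

Lemma det_MA1_cov (a : 'I_2 -> K) :
  \det (MA1_cov n a) = \prod_k (a 0 ^+ 2 + a 1 ^+ 2 + a 0 * a 1 * lam k).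
Proof. by rewrite MA1_covE dg_lin det_dg. Qed.

Lemma MA1_scoreE (y : 'cV[K]_n) (i : 'I_2) (a : 'I_2 -> K)
    (d := fun k => a 0 ^+ 2 + a 1 ^+ 2 + a 0 * a 1 * lam k) :
  (forall k, d k != 0) ->
  MA1_score y i a =
  \sum_k (2 * a i + a (i + 1) * lam k) *
         ((U *m y) k 0 ^+ 2 / d k ^+ 2 - (d k)^-1).
Proof.
move=> d_neq0; rewrite /MA1_score MA1_dcovE MA1_covE !dg_lin.
have -> : invmx (dg d) = dg (fun k => (d k)^-1).
  have dV : dg d *m dg (fun k => (d k)^-1) = 1%:M.
    rewrite dgM -dg1 /dg; congr (_ *m diag_mx _ *m _); apply/rowP=> k.
    by rewrite !mxE divff.
  have [du _] := mulmx1_unit dV.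
  by rewrite -[RHS](mulKmx du) dV mulmx1.
rewrite -(mulmxA y^T) -(mulmxA y^T) !dgM tr_dg quad_dg -sumrN -big_split /=.
apply: eq_bigr => k _; have := d_neq0 k; rewrite /d => dk; field.
by rewrite dk.
Qed.

End Diagonalisation.

(** * Genericity *)

(* Mathcomp's [map_resultant] only covers morphisms defined on a polynomial ring. *)
Lemma rmorph_resultant (K L : comNzRingType) (f : {rmorphism K -> L}) (p q : {poly K}) :
  f (lead_coef p) != 0 -> f (lead_coef q) != 0 ->
  f (resultant p q) = resultant (map_poly f p) (map_poly f q).
Proof.
move=> fp fq; rewrite /resultant /Sylvester_mx !size_map_poly_id0 //.
rewrite -det_map_mx /= map_col_mx; congr (\det (col_mx _ _));
  by apply: map_lin1_mx => v; rewrite map_poly_rV rmorphM /= map_rVpoly.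
Qed.

(** Surviving leading coefficients keep both sizes, so the resultant commutes with [f]; over a field
    it is non-zero exactly when the gcd is constant. *)
Lemma coprimep_map_resultant (K : comNzRingType) (L : fieldType)
    (f : {rmorphism K -> L}) (p q : {poly K}) :
  f (lead_coef p) != 0 -> f (lead_coef q) != 0 ->
  coprimep (map_poly f p) (map_poly f q) = (f (resultant p q) != 0).
Proof.
move=> fp fq; rewrite rmorph_resultant // resultant_eq0 -leqNgt.
rewrite /coprimep eqn_leq andb_idr // => _; rewrite size_poly_gt0 gcdp_eq0.
by rewrite -size_poly_eq0 size_map_poly_id0 // size_poly_eq0 negb_and -lead_coef_eq0
  (contraNneq _ fp) // => ->; rewrite rmorph0.
Qed.

Lemma rmorph_lead_coef_neq0 (K L : nzRingType) (f : {rmorphism K -> L}) (p : {poly K}) m :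
  (size p <= m.+1)%N -> f p`_m != 0 -> f (lead_coef p) != 0.
Proof.
move=> szp fm; rewrite lead_coefE (_ : (size p) = m.+1) //.
apply/eqP; rewrite eqn_leq szp ltnNge; apply: contra fm => lepm.
by rewrite nth_default // rmorph0.
Qed.

(* [P] is a resultant times leading coefficients, so that no degree drops under
   specialisation; [\sum_k v' k] is the leading coefficient of [data_poly]. *)
Lemma generic_coprime_criterion (K : idomainType) (L : numFieldType) n
    (lam v : 'I_n -> K) : (1 < n)%N ->
  exists P : K, forall f : {rmorphism K -> L},
  let lam' := f \o lam in let v' := f \o v in
  (f P != 0 -> (lik_crit lam' v')`_(2 * n).-1 != 0 /\
     coprimep (lik_crit lam' v') (lik_disc lam' v')) /\
  (\sum_k v' k != 0 -> (lik_crit lam' v')`_(2 * n).-1 != 0 ->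
     coprimep (lik_crit lam' v') (lik_disc lam' v') -> f P != 0).
Proof.
move=> n_gt1; pose F := lik_crit lam v; pose H := lik_disc lam v.
set m := (2 * n).-1; have mE : m.+1 = (2 * n)%N.
  by rewrite /m prednK // muln_gt0 (ltnW n_gt1).
have m_gt0 : (0 < m)%N.
  by rewrite -ltnS mE mul2n -addnn; apply: leq_trans n_gt1 (leq_addr _ _).
have szF : (size F <= m.+1)%N by rewrite mE size_lik_crit.
exists (F`_m * lead_coef H * resultant F H) => f /=.
rewrite -map_lik_crit -map_lik_disc coef_map -/F -/H; split.
  have fP : f (F`_m * lead_coef H * resultant F H) =
      f F`_m * f (lead_coef H) * f (resultant F H).
    by rewrite !rmorphM.
  rewrite fP !mulf_eq0 !negb_or => /andP[/andP[c1 c2] c3].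
  by rewrite coprimep_map_resultant // (rmorph_lead_coef_neq0 szF c1).
move=> v0 Fm cop; have lF := rmorph_lead_coef_neq0 szF Fm.
have F_neq0 : F != 0 by apply: contraNneq lF => ->; rewrite lead_coef0 rmorph0.
have lH : f (lead_coef H) != 0.
  (* The three factors are treated separately: the derivative has top coefficient m times that of
     [F], D is monic, and N has top coefficient the sum of the v_k. *)
  rewrite /H /lik_disc !lead_coefM !rmorphM /= (monicP (monic_spec_poly _)) rmorph1 mulr1.
  apply: mulf_neq0.
    apply: (@rmorph_lead_coef_neq0 _ _ _ _ m.-1).
      by rewrite prednK // -ltnS (leq_trans (lt_size_deriv F_neq0)).
    by rewrite coef_deriv -/F prednK // rmorphMn mulrn_eq0 negb_or Fm andbT -lt0n.
  apply: (@rmorph_lead_coef_neq0 _ _ _ _ n.-1).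
    by rewrite prednK ?size_data_poly // ltnW.
  by rewrite coef_data_poly rmorph_sum.
rewrite !rmorphM !mulf_eq0 !negb_or Fm lH /=.
by rewrite -coprimep_map_resultant.
Qed.

Section GenericData.
Variables (R : realType) (n : nat) (U : 'M[R]_n) (lam : 'I_n -> R).
Hypotheses (n_gt1 : (1 < n)%N) (UU : U *m U^T = 1%:M).
Hypotheses (lam_inj : injective lam) (lam_int : forall k, -2 < lam k < 2).

Let A : idomainType := {mpoly R[n]}.
Let lamA k : A := (lam k)%:MP.
Let vA k : A := (\sum_j U k j *: 'X_j) ^+ 2.
Let lamC k : R[i] := (lam k)%:C.

(** The data are indeterminates in [A]. Evaluation is allowed at complex points, since the special
    data need not be real. *)
Let ev (eta : 'I_n -> R[i]) : {rmorphism A -> R[i]} := mmap (real_complex R) eta.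

Let ev_lam eta : ev eta \o lamA = lamC.
Proof. by apply: funext => k; rewrite /= mmapC. Qed.

Let ev_v eta : ev eta \o vA = fun k => (\sum_j (U k j)%:C * eta j) ^+ 2.
Proof.
apply: funext => k; rewrite /= /vA rmorphXn /= rmorph_sum /=; congr (_ ^+ 2).
by apply: eq_bigr => j _; rewrite mmapZ mmapX mmap1U.
Qed.

Let spec2 : (spec_poly lamC).[2] != 0.
Proof.
rewrite horner_spec_poly; apply/prodf_neq0 => k _.
rewrite -(rmorph_nat (real_complex R)) -rmorphD fmorph_eq0.
by have := lam_int k => ?; apply: lt0r_neq0; lra.
Qed.

Let specN2 : (spec_poly lamC).[- 2] != 0.
Proof.
rewrite horner_spec_poly; apply/prodf_neq0 => k _.
rewrite -(rmorph_nat (real_complex R)) -rmorphN -rmorphD fmorph_eq0.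
by have := lam_int k => ?; apply: ltr0_neq0; lra.
Qed.

(** D'(2) is a sum of products of the positive real numbers 2 + lam_j. *)
Let deriv2 : (spec_poly lamC)^`().[2] != 0.
Proof.
rewrite deriv_spec_poly horner_sum.
have -> : \sum_k (spec_minor lamC k).[2] =
    (\sum_k \prod_(j | j != k) (2 + lam j))%:C.
  rewrite rmorph_sum; apply: eq_bigr => k _; rewrite horner_spec_minor rmorph_prod.
  by apply: eq_bigr => j _; rewrite rmorphD rmorph_nat.
rewrite (fmorph_eq0 (real_complex R)) psumr_neq0; last first.
  by move=> k _; apply: prodr_ge0 => j _; have := lam_int j; lra.
apply/hasP; exists (Ordinal (ltnW n_gt1)); rewrite ?mem_index_enum //=.
by apply: prodr_gt0 => j _; have := lam_int j; lra.
Qed.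

Let trace2 : \sum_k lamC k + 2 * n%:R != 0.
Proof.
have -> : \sum_k lamC k + 2 * n%:R = (\sum_k (lam k + 2))%:C.
  rewrite rmorph_sum; under [RHS]eq_bigr do rewrite rmorphD rmorph_nat.
  by rewrite big_split /= sumr_const card_ord mulr_natr.
rewrite (fmorph_eq0 (real_complex R)) psumr_neq0.
  apply/hasP; exists (Ordinal (ltnW n_gt1)); rewrite ?mem_index_enum //=.
  by have := lam_int (Ordinal (ltnW n_gt1)); lra.
by move=> k _; have := lam_int k; lra.
Qed.

Lemma generic_data : for_generic (fun y : 'cV[R]_n =>
  let v k := ((U *m y) k 0)%:C ^+ 2 in
  (lik_crit lamC v)`_(2 * n).-1 != 0 /\
  coprimep (lik_crit lamC v) (lik_disc lamC v)).
Proof.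
have lamC_inj : injective lamC by move=> k l /(fmorph_inj (real_complex R)) /lam_inj.
have [v [v1 v2 v3]] := exists_generic_data n_gt1 lamC_inj spec2 specN2 deriv2 trace2.
pose UC := map_mx (real_complex R) U.
(* Any complex [v] arises from data: choose square roots of its entries as eigenbasis coordinates
   and rotate back by U^T. *)
pose eta0 j : R[i] := (UC^T *m (\col_k sqrtC (v k))) j 0.
have eta0E : (fun k => (\sum_j (U k j)%:C * eta0 j) ^+ 2) = v.
  apply: funext => k; rewrite -[RHS]sqrtCK; congr (_ ^+ 2).
  transitivity ((UC *m (UC^T *m (\col_k sqrtC (v k)))) k 0).
    by rewrite [RHS]mxE; apply: eq_bigr => j _; rewrite [UC k j]mxE.
  by rewrite mulmxA /UC map_trmx -map_mxM UU map_mx1 mul1mx mxE.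
have [P PE] := @generic_coprime_criterion A R[i] n lamA vA n_gt1.
exists P.
  (* A real polynomial with a non-zero value at one complex point is not zero. *)
  have [_] := PE (ev eta0); rewrite ev_lam (etrans (ev_v eta0) eta0E) => /(_ v1 v2 v3).
  by apply: contraNneq => ->; rewrite rmorph0.
move=> y Py; pose eta j : R[i] := (y j 0)%:C.
have etaE : (fun k => (\sum_j (U k j)%:C * eta j) ^+ 2) =
    fun k => ((U *m y) k 0)%:C ^+ 2.
  apply: funext => k; congr (_ ^+ 2); rewrite mxE rmorph_sum.
  by apply: eq_bigr => j _; rewrite rmorphM.
have evE (p : {mpoly R[n]}) : ev eta p = (p.@[fun i => y i 0])%:C.
  rewrite /= mevalE /mmap rmorph_sum; apply: eq_bigr => mm _.
  rewrite rmorphM /mmap1 rmorph_prod; congr (_ * _).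
  by apply: eq_bigr => i _; rewrite rmorphXn.
have [+ _] := PE (ev eta); rewrite ev_lam (etrans (ev_v eta) etaE); apply.
by rewrite evE fmorph_eq0.
Qed.

End GenericData.

(** * The count for the likelihood equations of the model *)

Theorem theorem2p1 (R : realType) (n : nat) (hn : (1 < n)%N) :
  is_MA1_parametric_ML_degree R n (8 * (n - 1))%N.
Proof.
have [U [lam [UU lam_inj lam_int path_diag]]] := path_mx_diag R n.
have [P P0 PE] := generic_data hn UU lam_inj lam_int.
exists P => // y /PE[]; set lamC := fun k => (lam k)%:C; set v := fun k => _.
move=> top cop; have [s [us <- sE]] := score_eqs_count hn top cop.
pose UC := map_mx (real_complex R) U.
have UUC : UC *m UC^T = 1%:M by rewrite map_trmx -map_mxM UU map_mx1.
have path_diagC : path_mx R[i] n = UC^T *m diag_mx (\row_k lamC k) *m UC.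
  transitivity (map_mx (real_complex R) (path_mx R n)).
    by apply/matrixP=> i j; rewrite !mxE rmorph_nat.
  rewrite path_diag !map_mxM -map_trmx map_diag_mx; congr (_ *m diag_mx _ *m _).
  by apply/rowP=> k; rewrite !mxE.
pose g (a : 'rV[R[i]]_2) := (a 0 0, a 0 1).
have solE a : MA1_likelihood_solutions y a <-> g a \in s.
  rewrite sE /score_eqs /= /MA1_likelihood_solutions /= (det_MA1_cov UUC path_diagC).
  pose d k := a 0 0 ^+ 2 + a 0 1 ^+ 2 + a 0 0 * a 0 1 * lamC k.
  have vE k : (UC *m map_mx (real_complex R) y) k 0 ^+ 2 = v k.
    by rewrite -map_mxM mxE.
  have scE i : (forall k, d k != 0) ->
      MA1_score (map_mx (real_complex R) y) i (a 0) =
      \sum_k (2 * a 0 i + a 0 (i + 1) * lamC k) * (v k / d k ^+ 2 - (d k)^-1).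
    move=> d0; rewrite (MA1_scoreE UUC path_diagC) //.
    by apply: eq_bigr => k _; rewrite vE.
  have i11 : (1 + 1 : 'I_2) = 0 by apply: val_inj.
  split=> [[/prodf_neq0 d0 sc]|[d0 e1 e2]].
    have d0' k : d k != 0 by exact: d0.
    split=> //; first by have := sc 0; rewrite scE // add0r.
    by have := sc 1; rewrite scE // i11.
  split=> [|i]; first by apply/prodf_neq0 => k _; exact: d0.
  rewrite scE //; have [->|->] := ord2_cases i.
  - by rewrite add0r.
  - by rewrite i11.
pose h (p : R[i] * R[i]) : 'rV[R[i]]_2 := \row_j (if j == 0 then p.1 else p.2).
have gK : cancel g h.
  move=> a; apply/rowP=> j; rewrite mxE /g /=.
  have [->|->] := ord2_cases j.
    by rewrite eqxx.
  by [].
have hK : cancel h g by case=> p q; rewrite /g !mxE.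
(* The position in the duplicate-free list [s] is the bijection onto the first 8 (n - 1) natural
   numbers. *)
apply/card_set_bijP; exists (fun a => index (g a) s); split.
- by move=> a /solE; rewrite /= index_mem.
- move=> a b /set_mem/solE as_ /set_mem/solE bs /(congr1 (nth (g a) s)).
  by rewrite !nth_index // => /(can_inj gK).
move=> i /= lti; exists (h (nth 0 s i)); last by rewrite hK index_uniq.
by apply/solE; rewrite hK mem_nth.
Qed.
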